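(* Let $r\ge 4$ be an integer. The side-length triples $(r,s,t)$, with first entry the given $r$, of triangles associated with $D(4)$-triples are exactly the triples $$(r,s,t)=(r,\,r+a,\,r+b),$$ where $a,b$ are positive integers satisfying $$r^2-4=ab,\qquad 0<a<b,\qquad b-a<r.$$ The corresponding $D(4)$-triple is uniquely determined and is $\{a,b,a+b+2r\}$.
   Context: A $D(4)$-triple is a set of three distinct positive integers such that the product of any two distinct elements, increased by $4$, is a perfect square. For a $D(4)$-triple $\{a,b,c\}$ with $a<b<c$, put $r=\sqrt{ab+4}$, $s=\sqrt{ac+4}$, $t=\sqrt{bc+4}$; these are positive integers with $r<s<t$. If $r+s>t$, the (non-degenerate) triangle with side lengths $r,s,t$ is called the triangle associated with the $D(4)$-triple $\{a,b,c\}$, and $(r,s,t)$ (in this increasing order) is its side-length triple; if $r+s\le t$, no triangle is associated with $\{a,b,c\}$. *)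

(* Defs.v *)
From mathcomp Require Import all_boot.
From mathcomp Require Import finmap.

Set Implicit Arguments.
Unset Strict Implicit.
Unset Printing Implicit Defensive.

Local Open Scope fset_scope.
Local Open Scope nat_scope.

Definition D4_triple (T : {fset nat}) : Prop :=
  [/\ #|` T| = 3,
      forall x, x \in T -> 0 < x
    & forall x y, x \in T -> y \in T -> x != y ->
        exists k : nat, x * y + 4 = k ^ 2].

(* The square roots are rendered by their defining equations, which have at
   most one natural solution. A triple with r + s <= t satisfies this for no
   (r, s, t): it has no associated triangle. *)
Definition triangle_sides (T : {fset nat}) (r s t : nat) : Prop :=
  exists a b c : nat,
    [/\ T = [fset a; b; c], a < b < c,
        [/\ r ^ 2 = a * b + 4, s ^ 2 = a * c + 4 & t ^ 2 = b * c + 4]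
      & t < r + s].

(* Main.v *)
Require Import Defs.
From mathcomp Require Import all_boot.
From mathcomp Require Import finmap zify.

(** Put 2x = rs - at and 2y = rt - bs.  Then x, y are positive integers with
    2s = rx + ay, 2t = ry + bx and bx^2 - ay^2 = 4(b - a).  The value x = 1
    would force a = b, and x = 2 forces y = 2, that is s = r + a, t = r + b.
    If x >= 3 then y > x and bx > ay, so t < r + s, i.e.
    r(y - x) + (bx - ay) < 2r, leaves only y = x + 1; this is then excluded
    by a size estimate in terms of j = r - a and k = b - a. *)

Set Implicit Arguments.
Unset Strict Implicit.
Unset Printing Implicit Defensive.

Local Open Scope fset_scope.
Local Open Scope nat_scope.

(** The squares differ by an even number, so [m] and [n] have equal parity and the positive gap
    [m - n] is even. *)
Lemma half_diff_of_sqr (m n e : nat) :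
  m ^ 2 = n ^ 2 + 4 * e -> 0 < e -> exists2 x, 0 < x & m = n + 2 * x.
Proof.
move=> mnE e_gt0.
have lt_nm : n < m by rewrite -ltn_sqr; lia.
have odd_mn : odd m = odd n.
  by move: (congr1 odd mnE); rewrite oddD oddM !oddX /= addbF.
by exists (m - n)./2; lia.
Qed.

Lemma half_differences (a b c r s t : nat) :
  0 < a -> a < b -> b < c ->
  r ^ 2 = a * b + 4 -> s ^ 2 = a * c + 4 -> t ^ 2 = b * c + 4 ->
  exists x y, [/\ 0 < x, 0 < y, 2 * s = r * x + a * y, 2 * t = r * y + b * x
                & b * x ^ 2 + 4 * a = a * y ^ 2 + 4 * b].
Proof.
move=> a_gt0 lt_ab lt_bc rE sE tE.
have [k bE] : exists k, b = a + k by exists (b - a); lia.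
have [l cE] : exists l, c = b + l by exists (c - b); lia.
have [x x_gt0 xE] : exists2 x, 0 < x & r * s = a * t + 2 * x.
  (* Expanding gives [(rs)^2 - (at)^2 = 4(a(b + c - a) + 4)]; for [rt] and [bs] exchange [a] and
     [b]. *)
  apply: (@half_diff_of_sqr _ _ (a * (k + c) + 4)); last by lia.
  by rewrite !expnMn rE sE tE bE; lia.
have [y y_gt0 yE] : exists2 y, 0 < y & r * t = b * s + 2 * y.
  apply: (@half_diff_of_sqr _ _ (b * (a + l) + 4)); last by lia.
  by rewrite !expnMn rE sE tE cE; lia.
(* Eliminating [t] between [xE] and [yE] leaves the coefficient [r^2 - ab = 4] on [s]. *)
have sxy : 2 * s = r * x + a * y.
  have := congr1 (muln r) xE; have := congr1 (muln a) yE.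
  by have := congr1 (muln s) rE; lia.
have txy : 2 * t = r * y + b * x.
  have := congr1 (muln r) yE; have := congr1 (muln b) xE.
  by have := congr1 (muln t) rE; lia.
exists x, y; split=> //.
(* In [b(2s)^2 - a(2t)^2 = 16(b - a)] the cross terms cancel, leaving [(r^2 - ab)(bx^2 - ay^2)]. *)
have := congr1 (fun z => b * z ^ 2) sxy; have := congr1 (fun z => a * z ^ 2) txy.
have := congr1 (muln (b * x ^ 2)) rE; have := congr1 (muln (a * y ^ 2)) rE.
have := congr1 (muln b) sE; have := congr1 (muln a) tE.
clear; rewrite -!mulnn; lia.
Qed.

(** For [y = x + 1] the doubled inequality [t < r + s] reads [(b - a)x < r + a], which the
    conclusion refutes. *)
Lemma no_consecutive (a b r x : nat) :
  0 < a < b -> r ^ 2 = a * b + 4 ->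
  b * x ^ 2 + 4 * a = a * x.+1 ^ 2 + 4 * b -> r + a <= (b - a) * x.
Proof.
case/andP=> a_gt0 lt_ab rE xE; rewrite leqNgt; apply/negP => lt_kx.
have [k bE] : exists k, b = a + k by exists (b - a); lia.
subst b; have k_gt0 : 0 < k by lia.
have lt_ar : a < r by nia.
have [j rE'] : exists j, r = a + j by exists (r - a); lia.
subst r; have j_gt0 : 0 < j by lia.
rewrite addKn in lt_kx.
have kE : k * a + 4 = 2 * a * j + j ^ 2 by nia.
have xkE : k * x ^ 2 = 2 * a * x + a + 4 * k by nia.
(* Multiply [kx + 1 <= 2a + j] by [x] and insert [xkE]. *)
have le_x : a + 4 * k + x <= x * j by nia.
have j_gt1 : 1 < j by nia.
(* Since [j^2 >= 4], [kE] gives [ka >= 2aj]. *)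
have le_jk : 2 * j <= k by nia.
(* Now [kx >= 2jx >= 2a + 8k + 2x > 2a + j], against [lt_kx]. *)
nia.
Qed.

Lemma triangle_regular (a b c r s t : nat) :
  0 < a -> a < b -> b < c ->
  r ^ 2 = a * b + 4 -> s ^ 2 = a * c + 4 -> t ^ 2 = b * c + 4 -> t < r + s ->
  [/\ s = r + a, t = r + b & c = a + b + 2 * r].
Proof.
move=> a_gt0 lt_ab lt_bc rE sE tE lt_t.
have [x [y [x_gt0 y_gt0 sxy txy xyE]]] :=
  half_differences a_gt0 lt_ab lt_bc rE sE tE.
have [lt_x2|lt_2x|x2] := ltngtP x 2.
- have x1 : x = 1 by lia.
  subst x; have y1 : y = 1 by clear -y_gt0 lt_ab a_gt0 xyE; nia.
  subst y; lia.
- have lt_4x2 : 2 ^ 2 < x ^ 2 by rewrite ltn_sqr.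
  (* Here [a(y^2 - x^2) = (b - a)(x^2 - 4) > 0]. *)
  have lt_xy : x < y.
    rewrite -ltn_sqr -(ltn_pmul2l a_gt0).
    move: (x ^ 2) (y ^ 2) xyE lt_4x2 lt_ab; clear; nia.
  have lt_ay : a * y < b * x.
    rewrite -ltn_sqr !expnMn; have := congr1 (muln a) xyE.
    have : a * b * x ^ 2 <= b ^ 2 * x ^ 2.
      by rewrite leq_mul2r -mulnn leq_mul2r (ltnW lt_ab) !orbT.
    have : a * a < a * b by rewrite ltn_pmul2l.
    by rewrite -!mulnn; lia.
  have lt_sides : r * y + b * x < r * x + a * y + 2 * r by lia.
  have yE : y = x.+1 by clear -lt_xy lt_ay lt_sides; nia.
  subst y; have := @no_consecutive a b r x.
  rewrite a_gt0 lt_ab => /(_ isT rE xyE); rewrite mulnBl; lia.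
- subst x; have y2 : y = 2.
    apply/eqP; rewrite -eqn_sqr -(eqn_pmul2l a_gt0); lia.
  subst y; have sE' : s = r + a by lia.
  have tE' : t = r + b by lia.
  by split=> //; subst s; nia.
Qed.

(** Since [r^2 = ab + 4], [(r + a)^2 = a(a + b + 2r) + 4], and likewise for [b]; [b - a < r] is the
    triangle inequality. *)
Lemma regular_D4_triple (r a b : nat) :
  r ^ 2 = a * b + 4 -> 0 < a < b -> b - a < r ->
  D4_triple [fset a; b; a + b + 2 * r] /\
  triangle_sides [fset a; b; a + b + 2 * r] r (r + a) (r + b).
Proof.
move=> rE /andP[a_gt0 lt_ab] lt_r; set c := a + b + 2 * r.
have sE : (r + a) ^ 2 = a * c + 4 by rewrite /c; nia.
have tE : (r + b) ^ 2 = b * c + 4 by rewrite /c; nia.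
have lt_bc : b < c by rewrite /c; lia.
split; last by exists a, b, c; split=> //; lia.
split.
- by rewrite fsetUC cardfsU1 cardfs2 !inE; lia.
- by move=> x; rewrite !inE; lia.
- move=> x y; rewrite !inE.
  move=> /orP[/orP[]|] /eqP-> /orP[/orP[]|] /eqP->; rewrite ?eqxx // => _.
  + by exists r.
  + by exists (r + a).
  + by exists r; rewrite mulnC.
  + by exists (r + b).
  + by exists (r + a); rewrite mulnC.
  + by exists (r + b); rewrite mulnC.
Qed.

Lemma D4_triangle_regular (T : {fset nat}) (r s t : nat) :
  D4_triple T -> triangle_sides T r s t ->
  exists a b, [/\ r ^ 2 = a * b + 4, 0 < a < b, b - a < r,
                 s = r + a /\ t = r + b & T = [fset a; b; a + b + 2 * r]].
Proof.
move=> [_ T_gt0 _] [a [b [c [TE /andP[lt_ab lt_bc] [rE sE tE] lt_t]]]].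
have a_gt0 : 0 < a by apply: T_gt0; rewrite TE !inE eqxx.
have [sE' tE' cE] := triangle_regular a_gt0 lt_ab lt_bc rE sE tE lt_t.
by exists a, b; rewrite -cE; split=> //; lia.
Qed.

Theorem corollary4p2 (r : nat) (hr : 4 <= r) :
  (forall s t : nat,
     (exists T : {fset nat}, D4_triple T /\ triangle_sides T r s t) <->
     (exists a b : nat,
        [/\ r ^ 2 - 4 = a * b, 0 < a < b, b - a < r, s = r + a & t = r + b]))
  /\
  (forall a b : nat,
     r ^ 2 - 4 = a * b -> 0 < a < b -> b - a < r ->
     forall T : {fset nat},
       D4_triple T /\ triangle_sides T r (r + a) (r + b) <->
       T = [fset a; b; a + b + 2 * r]).
Proof.
(* The bound [hr] ensures that the subtraction is not truncated. *)
have addE a b : r ^ 2 - 4 = a * b -> r ^ 2 = a * b + 4 by nia.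
split=> [s t|a b /addE rE ab lt_r T]; split.
- move=> [T [D4T /(D4_triangle_regular D4T)]].
  move=> [a [b [rE ab lt_r [sE tE] _]]].
  by exists a, b; split=> //; rewrite rE addnK.
- move=> [a [b [/addE rE ab lt_r -> ->]]].
  by exists [fset a; b; a + b + 2 * r]; apply: regular_D4_triple.
- move=> [D4T /(D4_triangle_regular D4T)].
  (* Cancelling [r] in the two larger sides recovers [a] and [b], hence [T]. *)
  by move=> [a' [b' [_ _ _ [/addnI-> /addnI->] ->]]].
- by move=> ->; apply: regular_D4_triple.
Qed.
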